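(* Let $\gamma\ge 2$ be an integer and let $G$ be a connected graph with maximum degree $\Delta\ge 3$. Put $M=\Delta\frac{(\Delta-1)^{\gamma}-1}{\Delta-2}$. If the girth of $G$ satisfies $g(G)\le 2\gamma-1$, then $\chi_\gamma(G)\le M-1$.
   Context: Graphs are finite and simple. The $\gamma$-th power $G^\gamma$ of $G$ is the graph on the vertex set of $G$ in which two distinct vertices are adjacent if and only if their distance in $G$ is at most $\gamma$. $\chi_\gamma(G):=\chi(G^\gamma)$ is the chromatic number of $G^\gamma$. The girth $g(G)$ is the length of a shortest cycle, with $g(G)=+\infty$ if $G$ has no cycles. *)

(* Defs.v *)
From mathcomp Require Import all_boot.

Set Implicit Arguments.
Unset Strict Implicit.
Unset Printing Implicit Defensive.

Record sgraph := SGraph {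
  vertex :> finType;
  adj : rel vertex;
  adj_sym : symmetric adj;
  adj_irrefl : irreflexive adj }.

Definition connected_graph (G : sgraph) : Prop :=
  0 < #|G| /\ forall x y : G, connect (@adj G) x y.

Definition degree (G : sgraph) (x : G) : nat := #|[set y | adj x y]|.

Definition max_degree (G : sgraph) : nat := \max_(x : G) degree x.

(* Distances and girths live in option nat, where None stands for +oo. *)
Definition le_ext (a : option nat) (n : nat) : bool :=
  if a is Some k then k <= n else false.

(* The least k <= N satisfying P, or +oo if there is none. *)
Definition least_upto (N : nat) (P : pred nat) : option nat :=
  let k := find P (iota 0 N.+1) in if k <= N then Some k else None.

Lemma least_uptoP (N : nat) (P : pred nat) (n : nat) :
  reflect (exists k, [/\ k <= N, P k & k <= n]) (le_ext (least_upto N P) n).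
Proof.
rewrite /least_upto; set k := find _ _.
have find_le j : j <= N -> P j -> k <= j.
  move=> jN Pj; rewrite leqNgt; apply/negP => jk.
  by have := before_find 0 jk; rewrite nth_iota ?add0n ?Pj // ltnS.
apply: (iffP idP); last first.
  case=> j [jN Pj jn]; have kj := find_le _ jN Pj.
  by rewrite (leq_trans kj jN) /=; apply: leq_trans kj jn.
case: ifP => // kN kn; exists k; split=> //.
have hasP0 : has P (iota 0 N.+1) by rewrite has_find size_iota ltnS.
by have := nth_find 0 hasP0; rewrite nth_iota ?add0n // ltnS.
Qed.

Definition has_path (G : sgraph) (x y : G) (k : nat) : bool :=
  [exists p : k.-tuple G,
    [&& path (@adj G) x p, last x p == y & uniq (x :: p)]].

(* A path has fewer than #|G| edges, so the cut-off loses nothing: see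
   dist_leP. *)
Definition dist (G : sgraph) (x y : G) : option nat :=
  least_upto #|G| (has_path x y).

Lemma dist_leP (G : sgraph) (x y : G) (n : nat) :
  reflect (exists p : seq G,
             [/\ path (@adj G) x p, last x p = y & size p <= n])
          (le_ext (dist x y) n).
Proof.
apply: (iffP (least_uptoP _ _ _)).
  case=> k [_ /existsP[p /and3P[xp /eqP lp _]] kn].
  by exists (val p); rewrite size_tuple.
case=> p [xp lp pn]; case: (shortenP xp) lp => q xq uq sqp lq.
have qp : size q <= size p.
  by apply: uniq_leq_size => //; case/andP: uq.
exists (size q); split; last exact: leq_trans qp pn.
  have /andP[_ uq'] := uq.
  by rewrite -(card_uniqP uq') max_card.
by apply/existsP; exists (in_tuple q); rewrite /= xq lq eqxx.
Qed.

Lemma dist_le_sym (G : sgraph) (x y : G) (n : nat) :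
  le_ext (dist x y) n = le_ext (dist y x) n.
Proof.
suff imp (u v : G) : le_ext (dist u v) n -> le_ext (dist v u) n.
  by apply/idP/idP; apply: imp.
case/dist_leP=> p [up lp pn]; apply/dist_leP; exists (rev (belast u p)).
split; last by rewrite size_rev size_belast.
  rewrite -lp rev_path; apply: sub_path up => a b /=.
  by rewrite adj_sym.
by rewrite -lp; case: p {up pn lp} => //= a p; rewrite rev_cons last_rcons.
Qed.

Definition power_adj (G : sgraph) (gamma : nat) : rel G :=
  fun x y => (x != y) && le_ext (dist x y) gamma.

Lemma power_adj_sym (G : sgraph) (gamma : nat) :
  symmetric (@power_adj G gamma).
Proof. by move=> x y; rewrite /power_adj eq_sym dist_le_sym. Qed.

Lemma power_adj_irrefl (G : sgraph) (gamma : nat) :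
  irreflexive (@power_adj G gamma).
Proof. by move=> x; rewrite /power_adj eqxx. Qed.

Definition power (G : sgraph) (gamma : nat) : sgraph :=
  SGraph (@power_adj_sym G gamma) (@power_adj_irrefl G gamma).

Definition colorable (G : sgraph) (k : nat) : bool :=
  [exists f : {ffun G -> 'I_k},
    [forall x : G, forall y : G, adj x y ==> (f x != f y)]].

Lemma colorable_exists (G : sgraph) : exists k, colorable G k.
Proof.
exists #|G|; apply/existsP; exists [ffun x => enum_rank x].
apply/forallP=> x; apply/forallP=> y; apply/implyP=> xy.
rewrite !ffunE; apply: contraTneq xy => /enum_rank_inj ->.
by rewrite adj_irrefl.
Qed.

Definition chromatic_number (G : sgraph) : nat := ex_minn (colorable_exists G).

Definition chi_pow (gamma : nat) (G : sgraph) : nat :=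
  chromatic_number (power G gamma).

Definition has_cycle (G : sgraph) (k : nat) : bool :=
  (3 <= k) && [exists c : k.-tuple G, cycle (@adj G) c && uniq c].

(* Cycles have at most #|G| vertices: see girth_leP. *)
Definition girth (G : sgraph) : option nat := least_upto #|G| (has_cycle G).

Lemma girth_leP (G : sgraph) (n : nat) :
  reflect (exists c : seq G,
             [/\ 3 <= size c, cycle (@adj G) c, uniq c & size c <= n])
          (le_ext (girth G) n).
Proof.
apply: (iffP (least_uptoP _ _ _)).
  case=> k [_ /andP[k3 /existsP[c /andP[cc uc]]] kn].
  by exists (val c); rewrite size_tuple.
case=> c [c3 cc uc cn]; exists (size c); split=> //.
  by rewrite -(card_uniqP uc) max_card.
by rewrite /has_cycle c3; apply/existsP; exists (in_tuple c); rewrite /= cc.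
Qed.

(* Delta * ((Delta - 1) ^ gamma - 1) / (Delta - 2); the natural-number
   division is exact when Delta >= 3, by moore_numberE. *)
Definition moore_number (Delta gamma : nat) : nat :=
  (Delta * ((Delta - 1) ^ gamma - 1)) %/ (Delta - 2).

Lemma moore_numberE (Delta gamma : nat) : 3 <= Delta ->
  moore_number Delta gamma * (Delta - 2) = Delta * ((Delta - 1) ^ gamma - 1).
Proof.
case: Delta => [|[|d]] // _.
rewrite /moore_number divnK // dvdn_mull // !subSS !subn0 subn1 predn_exp.
exact: dvdn_mulr.
Qed.

(* Main.v *)
Require Import Defs.
From mathcomp Require Import all_boot.
From mathcomp Require Import zify.

(** The bound comes from colouring the power graph greedily with [M - 1]
    colours, where [M] is the Moore number: it is enough that every nonempty
    set [S] of vertices contains a vertex with at most [M - 2] power-neighbours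
    inside [S] ([degenerate_colorable]).

    A vertex [v] has at most [M] power-neighbours, because each of them is the
    end of one of the at most [M] non-backtracking walks of length between [1]
    and [gamma] that start at [v]. If [v] lies on a cycle with
    [l <= 2 * gamma - 1] vertices, then [2 * gamma] of these walks run around
    the cycle, one of each length in each direction, and together they reach
    at most [l - 1 <= 2 * gamma - 2] vertices other than [v]. So two walks are
    wasted and [v] has at most [M - 2] power-neighbours ([cycle_power_degree]).

    Let [C] be a cycle of length at most [2 * gamma - 1], and [S] a nonempty set
    of vertices. If [S] meets [C], a common vertex will do. If it does not,
    a walk from [S] to [C] leaves [S] for the last time at some vertex [w], and as
    [gamma >= 2] the next two vertices (continuing along [C] if necessary) are
    power-neighbours of [w] outside [S]; only [M - 2] of the power-neighbours of
    [w] can then be in [S] ([exit_pair]). *)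

Set Implicit Arguments.
Unset Strict Implicit.
Unset Printing Implicit Defensive.

(** * Greedy colouring *)

(** The vertex of small degree inside [S] is coloured after the rest of [S]:
    its neighbours there leave one of the [k] colours free. *)
Lemma degenerate_colorable (H : sgraph) (k : nat) :
  (forall S : {set H}, S != set0 ->
     exists2 v, v \in S & #|[set y | adj v y] :&: S| < k) ->
  colorable H k.
Proof.
move=> degen.
case: k degen => [|k] degen.
  (* No degree is below zero, so [H] has no vertices. *)
  have H0 (x : H) : False.
    have [|v _] := degen setT; last by rewrite ltn0.
    by apply/set0Pn; exists x.
  apply/existsP; exists [ffun x => match H0 x with end].
  by apply/forallP=> x; case: (H0 x).
have partial n : forall S : {set H}, #|S| = n ->
    exists f : H -> 'I_k.+1,
      forall x y, x \in S -> y \in S -> adj x y -> f x != f y.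
  elim: n => [|n IHn] S cardS.
    by exists (fun=> ord0) => x y; rewrite (cards0_eq cardS) inE.
  have [|v vS degv] := degen S; first by rewrite -card_gt0 cardS.
  have [|f fP] := IHn (S :\ v); first by move: (cardsD1 v S); rewrite vS; lia.
  set N := [set y | adj v y] :&: S in degv.
  have /subsetPn[c _ cN] : ~~ ([set: 'I_k.+1] \subset f @: N).
    apply: contraL degv => /subset_leq_card; rewrite cardsT card_ord -leqNgt.
    by move/leq_trans; apply; apply: leq_imset_card.
  have free y : y \in S -> adj v y -> c != f y.
    by move=> yS vy; apply: contraNneq cN => ->; apply: imset_f; rewrite !inE vy.
  exists (fun x => if x == v then c else f x) => x y xS yS xy.
  case: (eqVneq x v) xy => [->|xv] xy; case: (eqVneq y v) xy => [->|yv] xy.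
  - by rewrite adj_irrefl in xy.
  - exact: free.
  - by rewrite eq_sym free // adj_sym.
  - by apply: fP; rewrite // !inE ?xv ?yv.
have [f fP] := partial _ [set: H] erefl.
apply/existsP; exists (finfun f).
apply/forallP=> x; apply/forallP=> y; apply/implyP=> xy.
by rewrite !ffunE fP ?inE.
Qed.

Lemma chromatic_number_le (H : sgraph) (k : nat) :
  colorable H k -> chromatic_number H <= k.
Proof. by rewrite /chromatic_number; case: ex_minnP => m _ min /min. Qed.

(** * Non-backtracking walks *)

Section NonBacktracking.
Variable G : sgraph.
Implicit Types (v x y : G) (a : G * G).

Definition nb_succ a : {set G * G} :=
  [set b | [&& b.1 == a.2, adj a.1 a.2, adj b.1 b.2 & b.2 != a.1]].

(** Only the last arc of a walk is kept. Two walks with the same last arc have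
    the same end and the same continuations, so forgetting the rest can only
    lower the count. *)
Fixpoint nb_arcs v (n : nat) : {set G * G} :=
  if n is m.+1 then \bigcup_(a in nb_arcs v m) nb_succ a
  else [set a | (a.1 == v) && adj v a.2].

Lemma nb_arcs_adj v n a : a \in nb_arcs v n -> adj a.1 a.2.
Proof.
case: n => [|n] /=; first by rewrite inE => /andP[/eqP-> ->].
by case/bigcupP=> b _; rewrite inE => /and4P[].
Qed.

(** Walking back along the last arc of a non-backtracking walk leads to the end
    of the walk shortened by one step, so backtracking reaches nothing new. *)
Lemma path_nb_arcs v p : path (@adj G) v p -> last v p != v ->
  exists2 i, i < size p & exists2 a, a \in nb_arcs v i & a.2 = last v p.
Proof.
elim/last_ind: p => [|p y IHp] /=; first by rewrite eqxx.
rewrite rcons_path last_rcons size_rcons => /andP[vp xy] yv.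
have [xv|xv] := eqVneq (last v p) v.
  by exists 0 => //; exists (v, y); rewrite // inE eqxx -[in adj _ _]xv.
have [i ip [[w x] a_i /= xE]] := IHp vp xv; rewrite -{}xE in xy.
have [wy|wy] := eqVneq y w; last first.
  exists i.+1 => //; exists (x, y) => //=.
  apply/bigcupP; exists (w, x); rewrite // inE /= eqxx xy wy.
  by rewrite (nb_arcs_adj a_i).
case: i ip a_i => [|i] ip a_i.
  by move: a_i yv; rewrite inE /= wy => /andP[->].
move/bigcupP: a_i => [b b_i]; rewrite inE /= => /and4P[/eqP wb _ _ _].
by exists i; [lia | exists b; rewrite // -wb wy].
Qed.

Lemma leq_max_degree x : degree x <= max_degree G.
Proof. exact: leq_bigmax. Qed.

Lemma card_nb_succ a : #|nb_succ a| <= max_degree G - 1.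
Proof.
case: (boolP (adj a.1 a.2)) => [a_adj|/negPf a_adj]; last first.
  rewrite (_ : nb_succ a = set0) ?cards0 //.
  by apply/setP=> b; rewrite !inE a_adj andbF.
have : #|[set y | adj a.2 y] :\ a.1| <= max_degree G - 1.
  have := leq_max_degree a.2.
  by rewrite /degree (cardsD1 a.1) inE adj_sym a_adj; lia.
apply: leq_trans; rewrite -(card_in_imset (f := snd)); last first.
  move=> [b1 b2] [c1 c2]; rewrite !inE /= => /andP[/eqP-> _].
  by move=> /andP[/eqP-> _] ->.
apply/subset_leq_card/subsetP => z /imsetP[[b1 b2] + ->].
by rewrite !inE /= => /and4P[/eqP-> _ -> ->].
Qed.

Lemma leq_card_bigcup (T I : finType) (A : {set I}) (F : I -> {set T}) k :
  (forall i, i \in A -> #|F i| <= k) -> #|\bigcup_(i in A) F i| <= #|A| * k.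
Proof.
move=> Fk; rewrite -sum_nat_const.
apply: leq_trans (_ : \sum_(i in A) #|F i| <= _); last exact: leq_sum.
elim/big_rec2: _ => [|i n B _ Bn]; first by rewrite cards0.
by apply: leq_trans (leq_card_setU _ _) _; rewrite leq_add2l.
Qed.

(** Here [P n] stands for the last arcs of [p] chosen walks, extended forever
    by one step at a time. The chosen walks take up [p] of the
    [Delta * (Delta - 1) ^ n] places at every level: a last arc has at most
    [Delta - 1] continuations, and for a chosen walk one of them is again
    chosen, so only [Delta - 2] of them leave [P]. *)
Lemma card_nb_arcs_setD v (P : nat -> {set G * G}) p n :
  1 < max_degree G -> P 0 \subset nb_arcs v 0 -> #|P 0| = p ->
  (forall i, #|P i| <= p) ->
  (forall i a, a \in P i -> exists2 b, b \in nb_succ a & b \in P i.+1) ->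
  #|nb_arcs v n :\: P n| + p <= max_degree G * (max_degree G - 1) ^ n.
Proof.
move=> D2 P0 cardP0 cardP succP; elim: n => [|n IHn].
  have := cardsID (P 0) (nb_arcs v 0); rewrite (setIidPr P0) cardP0 addnC => ->.
  rewrite expn0 muln1.
  apply: leq_trans (leq_max_degree v); rewrite /degree.
  rewrite -(card_in_imset (f := snd)); last first.
    move=> [x y] [x' y']; rewrite !inE /=.
    by move=> /andP[/eqP-> _] /andP[/eqP-> _] ->.
  apply/subset_leq_card/subsetP => z /imsetP[[x y] + ->].
  by rewrite !inE /= => /andP[].
set D := max_degree G in D2 IHn *.
set E := nb_arcs v n in IHn.
have split_succ : nb_arcs v n.+1 :\: P n.+1 \subset
    (\bigcup_(a in E :\: P n) nb_succ a) :|: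
    (\bigcup_(a in P n) (nb_succ a :\: P n.+1)).
  apply/subsetP=> b /setDP[/bigcupP[a aE ba] bP].
  have [aP|aP] := boolP (a \in P n); apply/setUP; [right|left].
    by apply/bigcupP; exists a; rewrite // inE bP.
  by apply/bigcupP; exists a; rewrite // inE aP.
have cardE : #|\bigcup_(a in E :\: P n) nb_succ a| <= #|E :\: P n| * (D - 1).
  by apply: leq_card_bigcup => a _; apply: card_nb_succ.
have cardPn : #|\bigcup_(a in P n) (nb_succ a :\: P n.+1)| <= #|P n| * (D - 2).
  apply: leq_card_bigcup => a /succP[b ba bP].
  have := card_nb_succ a; rewrite -(cardsID (P n.+1)).
  have : 0 < #|nb_succ a :&: P n.+1| by apply/card_gt0P; exists b; rewrite inE ba.
  rewrite -/D; lia.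
have := leq_trans (subset_leq_card split_succ) (leq_card_setU _ _).
have cardPp : #|P n| * (D - 2) <= p * (D - 2) by rewrite leq_mul2r cardP orbT.
have : (#|E :\: P n| + p) * (D - 1) <= D * (D - 1) ^ n * (D - 1).
  by rewrite leq_mul2r IHn orbT.
have pE : p * (D - 1) = p * (D - 2) + p by rewrite -mulnSr; congr (_ * _); lia.
rewrite mulnDl pE expnSr mulnA; lia.
Qed.

Lemma moore_number_sum (D n : nat) : 3 <= D ->
  moore_number D n = \sum_(i < n) D * (D - 1) ^ i.
Proof.
move=> D3; apply/eqP; rewrite -(@eqn_pmul2r (D - 2)); last by lia.
rewrite moore_numberE // -big_distrr /= -mulnA subn1 subn1 predn_exp.
by rewrite [_.-1 * _]mulnC (_ : D.-1.-1 = D - 2) ?eqxx //; lia.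
Qed.

(** The power-neighbours of [v] are ends of non-chosen walks or lie in the set
    [Q] of ends of chosen ones; for each of the [gamma] lengths, choosing [p]
    walks saves [p]. *)
Lemma power_degree_walks v (P : nat -> {set G * G}) p gamma (Q : {set G}) :
  2 < max_degree G -> P 0 \subset nb_arcs v 0 -> #|P 0| = p ->
  (forall i, #|P i| <= p) ->
  (forall i a, a \in P i -> exists2 b, b \in nb_succ a & b \in P i.+1) ->
  (forall i a, a \in P i -> a.2 != v -> a.2 \in Q) ->
  @degree (power G gamma) v + gamma * p <=
    moore_number (max_degree G) gamma + #|Q|.
Proof.
move=> D3 P0 cardP0 cardP succP PQ.
pose E i := [set a.2 | a in nb_arcs v i :\: P i].
have cover : [set y | power_adj gamma v y] \subset (\bigcup_(i < gamma) E i) :|: Q.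
  apply/subsetP=> y; rewrite inE => /andP[vy /dist_leP[q [vq qy qg]]].
  have [|i iq [a a_i aE]] := path_nb_arcs vq; first by rewrite qy eq_sym.
  have [aP|aP] := boolP (a \in P i); apply/setUP; [right|left].
    by rewrite -qy -aE (PQ i) // aE qy eq_sym.
  apply/bigcupP; exists (Ordinal (leq_trans iq qg)) => //.
  by apply/imsetP; exists a; rewrite ?inE ?aP // aE.
have deg_le : @degree (power G gamma) v <= #|\bigcup_(i < gamma) E i| + #|Q|.
  exact: leq_trans (subset_leq_card cover) (leq_card_setU _ _).
have cardE : #|\bigcup_(i < gamma) E i| + gamma * p <=
    moore_number (max_degree G) gamma.
  rewrite moore_number_sum //.
  apply: leq_trans (_ : \sum_(i < gamma) (#|nb_arcs v i :\: P i| + p) <= _).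
    rewrite big_split sum_nat_const card_ord leq_add2r /=.
    elim/big_rec2: _ => [|i m B _ Bm]; first by rewrite cards0.
    apply: leq_trans (leq_card_setU _ _) _; rewrite leq_add //.
    exact: leq_imset_card.
  apply: leq_sum => i _; apply: card_nb_arcs_setD => //; lia.
lia.
Qed.

Lemma power_degree_le v gamma : 2 < max_degree G ->
  @degree (power G gamma) v <= moore_number (max_degree G) gamma.
Proof.
move=> D3.
have := @power_degree_walks v (fun=> set0) 0 gamma set0 D3.
rewrite !cards0 muln0 !addn0; apply=> //.
- exact: sub0set.
- by move=> i a; rewrite inE.
- by move=> i a; rewrite inE.
Qed.

End NonBacktracking.

(** * Short cycles *)

Lemma next_next_neq (T : eqType) (c : seq T) x :
  uniq c -> 2 < size c -> x \in c -> next c (next c x) != x.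
Proof.
move=> uc c3 xc; have [i s cE] := rot_to xc.
rewrite -!(next_rot i uc) cE.
move: uc c3; rewrite -(rot_uniq i) -(size_rot i) cE.
case: s {cE} => [|a [|b s]] //= /andP[]; rewrite !inE !negb_or eqxx.
by case/and3P=> xa xb _ _ _; rewrite [a == x]eq_sym (negPf xa) eqxx eq_sym.
Qed.

Section Cycle.
Variables (G : sgraph) (c : seq G).
Hypotheses (c_cycle : cycle (@adj G) c) (c_uniq : uniq c) (c3 : 2 < size c).
Implicit Types x y v : G.

Lemma adj_next x : x \in c -> adj x (next c x).
Proof. exact: next_cycle. Qed.

Lemma adj_prev x : x \in c -> adj x (prev c x).
Proof. by rewrite adj_sym; apply: prev_cycle. Qed.

Lemma prev_prev_neq x : x \in c -> prev c (prev c x) != x.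
Proof.
move=> xc; apply: contraNneq (next_next_neq c_uniq c3 xc) => xE.
by rewrite -{1}xE !next_prev.
Qed.

Lemma next_neq_prev x : x \in c -> next c x != prev c x.
Proof.
move=> xc; apply: contraNneq (next_next_neq c_uniq c3 xc) => ->.
by rewrite next_prev.
Qed.

(** The two walks around the cycle from [v], one in each direction, after
    [n.+1] steps; they run on past [v] when [n] exceeds the cycle length. *)
Definition cycle_arcs v n : {set G * G} :=
  [set (iter n (next c) v, iter n.+1 (next c) v);
       (iter n (prev c) v, iter n.+1 (prev c) v)].

(** Counting walks rather than layers of the ball around [v] makes the argument
    work for every cycle through [v], even one with shortcuts: the [2 * gamma]
    walks around it are set against its [size c - 1] vertices other than [v]. *)
Lemma cycle_power_degree v gamma :
  2 < max_degree G -> v \in c -> size c < 2 * gamma ->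
  @degree (power G gamma) v + 2 <= moore_number (max_degree G) gamma.
Proof.
move=> D3 vc cg.
have nextc n : iter n (next c) v \in c by elim: n => //= n; rewrite mem_next.
have prevc n : iter n (prev c) v \in c by elim: n => //= n; rewrite mem_prev.
have cardQ : #|[set x in c] :\ v| + 1 = size c.
  have := cardsD1 v [set x in c].
  rewrite inE vc cardsE (card_uniqP c_uniq); lia.
suff : @degree (power G gamma) v + gamma * 2 <=
    moore_number (max_degree G) gamma + #|[set x in c] :\ v| by lia.
apply: (@power_degree_walks _ v (cycle_arcs v)) => //.
- apply/subsetP=> a /set2P[]->; rewrite inE /= eqxx /=.
    exact: adj_next.
  exact: adj_prev.
- by rewrite cards2 xpair_eqE /= eqxx /= next_neq_prev.
- by move=> i; rewrite cards2; case: (_ == _).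
- move=> i a /set2P[]->.
    exists (iter i.+1 (next c) v, iter i.+2 (next c) v); last exact: set21.
    by rewrite inE /= eqxx !adj_next ?mem_next // next_next_neq.
  exists (iter i.+1 (prev c) v, iter i.+2 (prev c) v); last exact: set22.
  by rewrite inE /= eqxx !adj_prev ?mem_prev // prev_prev_neq.
- move=> i a /set2P[]-> /= av; rewrite in_setD1 av inE.
    by rewrite mem_next nextc.
  by rewrite mem_prev prevc.
Qed.

(** After its last visit to [S], the walk steps out to some [u]. If [u] is not
    yet on the cycle, the walk goes on for another step outside [S]; otherwise
    the cycle provides the second vertex. *)
Lemma exit_pair (S : {set G}) x p :
  (forall y, y \in S -> y \notin c) -> x \in S -> path (@adj G) x p ->
  last x p \in c ->
  exists w u u', [/\ w \in S, u \notin S, u' \notin S &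
                       [/\ adj w u, adj u u' & u != u']].
Proof.
move=> Sc; have [n] := ubnP (size p).
elim: n x p => // n IHn x [|u p] /= pn xS; first by rewrite (negPf (Sc _ xS)).
case/andP=> xu up lp.
have [uS|uS] := boolP (u \in S); first exact: IHn uS up lp.
have [uc|uc] := boolP (u \in c).
  exists x, u, (next c u); have u_next := adj_next uc; split=> //.
    by apply/negP => /Sc; rewrite mem_next uc.
  by split=> //; apply: contraTneq u_next => <-; rewrite adj_irrefl.
case: p up lp pn => [|u' p] /= up lp pn; first by rewrite lp in uc.
have {up} [uu' up] := andP up.
have [u'S|u'S] := boolP (u' \in S); first exact: IHn (ltnW pn) u'S up lp.
exists x, u, u'; split=> //; split=> //.
by apply: contraTneq uu' => <-; rewrite adj_irrefl.
Qed.

End Cycle.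

Theorem corollary2p6 (gamma : nat) (G : sgraph) (Delta : nat)
  (gamma_ge2 : 2 <= gamma)
  (G_connected : connected_graph G)
  (G_max_degree : max_degree G = Delta)
  (Delta_ge3 : 3 <= Delta)
  (G_girth : le_ext (girth G) (2 * gamma - 1)) :
  chi_pow gamma G <= moore_number Delta gamma - 1.
Proof.
have [_ G_conn] := G_connected; rewrite -{}G_max_degree in Delta_ge3 *.
have [c [c3 c_cycle c_uniq cg]] := girth_leP _ _ G_girth.
have {}cg : size c < 2 * gamma by lia.
apply/chromatic_number_le/degenerate_colorable => S /set0Pn[x xS].
have [/exists_inP[v vS vc]|Sc] := boolP [exists v in S, v \in c].
  exists v => //; have := cycle_power_degree c_cycle c_uniq c3 Delta_ge3 vc cg.
  have := subset_leq_card (subsetIl [set y | @adj (power G gamma) v y] S).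
  rewrite /degree; lia.
have {}Sc y : y \in S -> y \notin c.
  by move=> yS; apply: contra Sc => yc; apply/exists_inP; exists y.
have [d dc] : exists d, d \in c.
  by case: c c3 {c_cycle c_uniq cg Sc} => // d ? _; exists d; rewrite mem_head.
have /connectP[p xp pd] := G_conn x d; rewrite pd in dc.
have [w [u [u' [wS uS u'S [wu uu' uDu']]]]] := exit_pair c_cycle Sc xS xp dc.
exists w => //; set N := [set y | @adj (power G gamma) w y].
have pair_sub : [set u; u'] \subset N :\: S.
  apply/subsetP=> z /set2P[]->; rewrite !inE ?uS ?u'S /= /power_adj.
    apply/andP; split; first by apply: contraNneq uS => <-.
    by apply/dist_leP; exists [:: u]; rewrite /= wu; split=> //; lia.
  apply/andP; split; first by apply: contraNneq u'S => <-.
  by apply/dist_leP; exists [:: u; u']; rewrite /= wu uu'; split=> //; lia.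
have out2 : 2 <= #|N :\: S|.
  by have := subset_leq_card pair_sub; rewrite cards2 uDu'.
have := power_degree_le w gamma Delta_ge3.
rewrite /degree -/N -(cardsID S N); lia.
Qed.
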